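(* Let $F:2^N\to\mathbb{R}$ be an $\varepsilon$-approximately submodular function with $0\le\varepsilon<1$ and let $k\ge1$. Then the set $S$ returned by the greedy algorithm satisfies $$F(S)\geq \frac{1}{1+\frac{4k\varepsilon}{(1-\varepsilon)^2}}\left(1-\left(\frac{1-\varepsilon}{1+\varepsilon}\right)^{2k}\left(1-\frac1k\right)^k\right)\max_{S':|S'|\le k}F(S').$$ In particular, for $k\geq2$, any constant $0\le\delta<1$ and $\varepsilon=\frac{\delta}{k}$, this approximation ratio is constant and lower-bounded by $1-\frac1e-16\delta$.
   Context: Submodular functions are normalized ($f(\emptyset)=0$) and monotone; $f$ is submodular if $f(S\cup T)+f(S\cap T)\le f(S)+f(T)$ for all $S,T\subseteq N$. $F$ is $\varepsilon$-approximately submodular if there exists such a submodular $f$ with $(1-\varepsilon)f(S)\leq F(S)\leq (1+\varepsilon)f(S)$ for all $S\subseteq N$. The greedy algorithm starts from $S=\emptyset$ and, for $k$ iterations, sets $S\leftarrow S\cup\{a^*\}$ where $a^*\in\arg\max_{a\in N\setminus S}F(S\cup\{a\})$; it returns $S$. *)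

(* Defs.v *)
From mathcomp Require Import all_boot all_order all_algebra.
From mathcomp Require Import reals.

Set Implicit Arguments.
Unset Strict Implicit.
Unset Printing Implicit Defensive.

Import Order.TTheory GRing.Theory Num.Theory.
Local Open Scope ring_scope.

Definition normalized (R : realType) (N : finType) (f : {set N} -> R) : Prop :=
  f set0 = 0.

Definition monotone (R : realType) (N : finType) (f : {set N} -> R) : Prop :=
  forall S T : {set N}, S \subset T -> f S <= f T.

(* Submodular functions are normalized and monotone by convention. *)
Definition submodular (R : realType) (N : finType) (f : {set N} -> R) : Prop :=
  [/\ normalized f,
      monotone f
    & forall S T : {set N}, f (S :|: T) + f (S :&: T) <= f S + f T].

Definition approx_submodular (R : realType) (N : finType) (eps : R)
    (F : {set N} -> R) : Prop :=
  exists f : {set N} -> R,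
    submodular f /\
    forall S : {set N}, (1 - eps) * f S <= F S /\ F S <= (1 + eps) * f S.

Definition greedy_choice (R : realType) (N : finType) (F : {set N} -> R)
    (S : {set N}) (a : N) : Prop :=
  a \notin S /\ forall b : N, b \notin S -> F (b |: S) <= F (a |: S).

(* [greedy F k S]: S is a possible result of k iterations of the greedy
   algorithm, ties in the argmax being broken arbitrarily.  An iteration that
   finds no element left to add leaves the set unchanged, so that k may exceed
   the size of the ground set. *)
Inductive greedy (R : realType) (N : finType) (F : {set N} -> R) :
    nat -> {set N} -> Prop :=
| greedy_init : greedy F 0 set0
| greedy_add k S a :
    greedy F k S -> greedy_choice F S a -> greedy F k.+1 (a |: S)
| greedy_full k : greedy F k setT -> greedy F k.+1 setT.

(* The empty set has cardinal at most k, so starting from [F set0] gives the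
   maximum itself. *)
Definition max_upto (R : realType) (N : finType) (F : {set N} -> R) (k : nat)
    : R :=
  \big[Num.max/F set0]_(S : {set N} | (#|S| <= k)%N) F S.

Definition greedy_ratio (R : realType) (eps : R) (k : nat) : R :=
  1 / (1 + 4 * k%:R * eps / (1 - eps) ^+ 2) *
  (1 - ((1 - eps) / (1 + eps)) ^+ (2 * k) * (1 - 1 / k%:R) ^+ k).

(* Main.v *)
Require Import Defs.
From mathcomp Require Import all_boot all_order all_algebra.
From mathcomp Require Import reals sequences exp.
From mathcomp Require Import ring lra.

Import Order.TTheory GRing.Theory Num.Theory.
Local Open Scope ring_scope.

(** With a = (1-eps)/(1+eps), submodularity of the witness f and the greedy
    choice give F(S_{i+1}) >= (a^2/k) F(O) + q F(S_i) for every |O| <= k, where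
    q = a^2 (1-1/k).  Since a^2/k = r (1-q) with r = 1/(1 + 4 k eps/(1-eps)^2),
    iterating yields F(S_i) >= r (1 - q^i) F(O), and i = k is the claimed bound.
    The recurrence holds with a in place of a^2; the square is what makes the
    closed form the stated one. *)

Lemma submodular_ge0 {R : realType} {N : finType} {f : {set N} -> R}
    (S : {set N}) :
  submodular f -> 0 <= f S.
Proof. by case=> f0 fmono _; rewrite -f0 fmono ?sub0set. Qed.

(** Peel off one [o] of [O]: submodularity is applied to [S :|: O :\ o] and [o |: S], whose
    intersection contains [S], so its value is at least [f S] by monotonicity. *)
Lemma submodular_marginals {R : realType} {N : finType} {f : {set N} -> R}
    (S O : {set N}) :
  submodular f -> f (S :|: O) <= f S + \sum_(o in O) (f (o |: S) - f S).
Proof.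
move=> [_ fmono fsub].
have [n] := ubnP #|O|; elim: n O => // n IHn O; rewrite ltnS => leOn.
have [->|[o oO]] := set_0Vmem O; first by rewrite big_set0 setU0 addr0.
have ltO : (#|O :\ o| < n)%N.
  by rewrite (leq_trans _ leOn)// [leqRHS](cardsD1 o) oO.
have /= := fsub (S :|: O :\ o) (o |: S).
have -> : S :|: O :\ o :|: (o |: S) = S :|: O.
  by rewrite setUCA setUAC setUid setUCA setD1K.
have := fmono S ((S :|: O :\ o) :&: (o |: S)).
rewrite subsetI subsetUl subsetUr => /(_ isT).
have := IHn _ ltO; rewrite (big_setD1 o oO) /=; lra.
Qed.

(** Here [s], [o] stand for [f S], [f O]; [x], [w] for [F S], [F O]; [y] for the next greedy value;
    [K] for [k]. *)
Lemma greedy_step {R : realType} {eps K s o x w y : R} :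
  0 <= eps < 1 -> 1 <= K -> 0 <= s -> 0 <= o ->
  x <= (1 + eps) * s -> w <= (1 + eps) * o ->
  (1 - eps) * o <= (1 - eps) * s + K * (y - (1 - eps) * s) ->
  ((1 - eps) / (1 + eps)) ^+ 2 / K * w +
    ((1 - eps) / (1 + eps)) ^+ 2 * (1 - 1 / K) * x <= y.
Proof.
move=> /andP[e0 e1] K1 s0 o0 xs wo oy; set a := (1 - eps) / (1 + eps).
have K0 : 0 < K by lra.
have a0 : 0 <= a by rewrite divr_ge0//; lra.
have a1 : a <= 1 by rewrite ler_pdivrMr; lra.
(* The second factor [a] is dropped only on the nonnegative side, since [u] has no assumed sign. *)
have sq u v : 0 <= v -> u <= (1 + eps) * v -> a ^+ 2 * u <= (1 - eps) * v.
  move=> v0 uv; have -> : (1 - eps) * v = a * ((1 + eps) * v).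
    by rewrite /a; field; lra.
  have au : a * u <= a * ((1 + eps) * v) by rewrite ler_wpM2l.
  have v1 : 0 <= (1 + eps) * v by rewrite mulr_ge0//; lra.
  have := ler_wpM2l a0 au; rewrite mulrA -expr2 => /le_trans; apply.
  by rewrite ler_piMl// mulr_ge0.
have wo' := sq _ _ o0 wo; have xs' := sq _ _ s0 xs.
rewrite -(ler_pM2l K0).
have -> : K * (a ^+ 2 / K * w + a ^+ 2 * (1 - 1 / K) * x) =
          a ^+ 2 * w + (K - 1) * (a ^+ 2 * x) by field; lra.
have : (K - 1) * (a ^+ 2 * x) <= (K - 1) * ((1 - eps) * s).
  by rewrite ler_wpM2l//; lra.
lra.
Qed.

(* The hypotheses on [y] are satisfied by [F S'] for [S'] the next greedy set,
   including when [S] is already the whole ground set. *)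
Lemma marginal_gain {R : realType} {N : finType} {f : {set N} -> R}
    {eps y : R} {k : nat} {S O : {set N}} :
  submodular f -> eps < 1 -> (#|O| <= k)%N ->
  (1 - eps) * f S <= y ->
  (forall o, o \notin S -> (1 - eps) * f (o |: S) <= y) ->
  (1 - eps) * f O <= (1 - eps) * f S + k%:R * (y - (1 - eps) * f S).
Proof.
move=> fsub e1 Ok ySy yo.
have [_ fmono _] := fsub.
have le0 : 0 <= 1 - eps by lra.
have fO : f O <= f S + \sum_(o in O) (f (o |: S) - f S).
  exact: le_trans (fmono _ _ (subsetUr S O)) (submodular_marginals S O fsub).
apply: (le_trans (ler_wpM2l le0 fO)); rewrite mulrDr lerD2l mulr_sumr.
apply: (@le_trans _ _ (\sum_(o in O) (y - (1 - eps) * f S))).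
  apply: ler_sum => o _; rewrite mulrBr lerD2r.
  have [oS|/yo//] := boolP (o \in S).
  by rewrite (setUidPr _)// sub1set.
(* The [#|O|] equal terms are nonnegative by [ySy], so their number may be raised to [k]. *)
by rewrite sumr_const -[leLHS]mulr_natl ler_wpM2r ?subr_ge0// ler_nat.
Qed.

Lemma greedy_bound {R : realType} {N : finType} {F : {set N} -> R} {eps : R}
    {k i : nat} {S O : {set N}} :
  0 <= eps < 1 -> (1 <= k)%N -> approx_submodular eps F -> (#|O| <= k)%N ->
  greedy F i S ->
  1 / (1 + 4 * k%:R * eps / (1 - eps) ^+ 2) *
    (1 - (((1 - eps) / (1 + eps)) ^+ 2 * (1 - 1 / k%:R)) ^+ i) * F O <= F S.
Proof.
move=> e01 k1 [f [fsub fF]] Ok; have /andP[e0 e1] := e01.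
have K1 : 1 <= k%:R :> R by rewrite ler1n.
set r := 1 / _; set a := (1 - eps) / (1 + eps); set q := a ^+ 2 * _.
have q0 : 0 <= q.
  by rewrite mulr_ge0 ?sqr_ge0// subr_ge0 ler_pdivrMr; lra.
(* The 4 in [r] comes from [(1 + eps) ^+ 2 - (1 - eps) ^+ 2 = 4 * eps]. *)
have rE : a ^+ 2 / k%:R = r * (1 - q).
  rewrite /r /q /a; field.
  have : 0 <= k%:R * eps by rewrite mulr_ge0//; lra.
  have : 0 < (1 - eps) ^+ 2 by rewrite exprn_gt0//; lra.
  by move=> h1 h2; rewrite !lt0r_neq0//; lra.
have [f0 fmono _] := fsub.
have step j T y : r * (1 - q ^+ j) * F O <= F T -> (1 - eps) * f T <= y ->
    (forall o, o \notin T -> (1 - eps) * f (o |: T) <= y) ->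
    r * (1 - q ^+ j.+1) * F O <= y.
  move=> IH yT yo.
  have := greedy_step e01 K1 (submodular_ge0 T fsub) (submodular_ge0 O fsub)
    (fF T).2 (fF O).2 (marginal_gain fsub e1 Ok yT yo).
  rewrite -/a rE -/q; apply: le_trans.
  have := ler_wpM2l q0 IH; rewrite exprS; lra.
elim=> {i S} [|i S b _ IH [bS bmax]|i _ IH].
- by have [] := fF set0; rewrite f0 expr0 subrr !mulr0 mul0r.
- apply: (step _ S) => // [|o oS].
    apply: le_trans (fF (b |: S)).1.
    by rewrite ler_wpM2l ?fmono ?subsetUr//; lra.
  exact: le_trans (fF (o |: S)).1 (bmax o oS).
(* No element lies outside [setT], so the condition on new elements is vacuous. *)
- by apply: (step _ setT) => // [|o]; [exact: (fF setT).1|rewrite inE].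
Qed.

Lemma greedy_ratioE {R : realType} (eps : R) (k : nat) :
  greedy_ratio eps k = 1 / (1 + 4 * k%:R * eps / (1 - eps) ^+ 2) *
    (1 - (((1 - eps) / (1 + eps)) ^+ 2 * (1 - 1 / k%:R)) ^+ k).
Proof. by rewrite /greedy_ratio exprM -exprMn. Qed.

(** This is [1 + x <= expR x] at [x = - (1 / k)], raised to the power [k]. *)
Lemma expr_one_sub_inv_le {R : realType} {k : nat} :
  (1 <= k)%N -> (1 - 1 / k%:R) ^+ k <= 1 / expR 1 :> R.
Proof.
move=> k1; have K1 : 1 <= k%:R :> R by rewrite ler1n.
have -> : 1 / expR 1 = expR (- (1 / k%:R)) ^+ k :> R.
  rewrite -expRM_natl mulrN [k%:R * _]mulrC divfK.
    by rewrite expRN div1r.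
  by rewrite lt0r_neq0//; lra.
rewrite lerXn2r ?nnegrE ?expR_ge0//; last exact: expR_ge1Dx.
by rewrite subr_ge0 ler_pdivrMr; lra.
Qed.

(** From [k >= 2] follows [eps <= 1 / 2], so [(1 - eps) ^+ 2 >= 1 / 4] turns [4 * delta] into
    [16 * delta]. The power of [(1 - eps) / (1 + eps)] is at most 1. *)
Lemma greedy_ratio_ge {R : realType} {delta : R} {k : nat} :
  0 <= delta < 1 -> (2 <= k)%N ->
  (1 - 1 / expR 1) / (1 + 16 * delta) <= greedy_ratio (delta / k%:R) k.
Proof.
move=> /andP[d0 d1] k2; have K2 : 2 <= k%:R :> R by rewrite ler_nat.
have K0 : 0 < k%:R :> R by lra.
set eps := delta / k%:R.
have e0 : 0 <= eps by rewrite divr_ge0//; lra.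
have eh : eps <= 1 / 2 by rewrite ler_pdivrMr//; lra.
have E1 : 1 / expR 1 <= 1 :> R.
  by rewrite ler_pdivrMr ?expR_gt0// mul1r ltW// expR_gt1.
have sq : 1 / 4 <= (1 - eps) ^+ 2.
  have : (1 / 2) ^+ 2 <= (1 - eps) ^+ 2 by rewrite lerXn2r ?nnegrE; lra.
  lra.
rewrite mulrC /greedy_ratio; apply: ler_pM.
- by rewrite invr_ge0; lra.
- by rewrite subr_ge0.
- have -> : 4 * k%:R * eps = 4 * delta by rewrite /eps; field; lra.
  have ge : 0 <= 4 * delta / (1 - eps) ^+ 2 by rewrite divr_ge0//; lra.
  rewrite div1r lef_pV2 ?posrE; [|lra..].
  rewrite lerD2l ler_pdivrMr; last lra.
  have : 16 * delta * (1 / 4) <= 16 * delta * (1 - eps) ^+ 2.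
    by rewrite ler_wpM2l//; lra.
  lra.
- rewrite lerD2l lerN2; apply: le_trans (expr_one_sub_inv_le (ltnW k2)).
  rewrite ler_piMl ?exprn_ge0 ?subr_ge0 ?ler_pdivrMr//; first lra.
  rewrite exprn_ile1 ?divr_ge0 ?ler_pdivrMr//; lra.
Qed.

Theorem theorem3 (R : realType) :
  (forall (N : finType) (F : {set N} -> R) (eps : R) (k : nat) (S : {set N}),
      0 <= eps < 1 ->
      (1 <= k)%N ->
      approx_submodular eps F ->
      greedy F k S ->
      F S >= greedy_ratio eps k * max_upto F k)
  /\
  (forall delta : R, 0 <= delta < 1 ->
      (exists2 c : R, 0 < c &
         forall k : nat, (2 <= k)%N -> c <= greedy_ratio (delta / k%:R) k)
      /\
      (forall k : nat, (2 <= k)%N ->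
         greedy_ratio (delta / k%:R) k >= 1 - 1 / expR 1 - 16 * delta)).
Proof.
split=> [N F eps k S e01 k1 Fsub Sgr|delta d01].
  have bound (O : {set N}) : (#|O| <= k)%N -> greedy_ratio eps k * F O <= F S.
    by move=> Ok; rewrite greedy_ratioE; exact: greedy_bound.
  rewrite /max_upto; apply: (big_ind (fun x => greedy_ratio eps k * x <= F S)).
  - by apply: bound; rewrite cards0.
  - by move=> x y hx hy; case: (leP x y).
  - exact: bound.
have /andP[d0 d1] := d01.
have E1 : 1 / expR 1 < 1 :> R.
  by rewrite ltr_pdivrMr ?expR_gt0// mul1r expR_gt1.
have E0 : 0 < 1 / expR 1 :> R by rewrite divr_gt0 ?expR_gt0.
split.
  (* This quotient stays positive even where [1 - 1 / expR 1 - 16 * delta] is negative. *)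
  exists ((1 - 1 / expR 1) / (1 + 16 * delta)); last first.
    by move=> k; exact: greedy_ratio_ge.
  by rewrite divr_gt0//; lra.
move=> k k2; apply: le_trans (greedy_ratio_ge d01 k2).
(* With [c = 1 - 1 / expR 1] and [x = 16 * delta], [(c - x) * (1 + x) = c - x / expR 1 - x ^+ 2 <=
   c]. *)
rewrite ler_pdivlMr; last lra.
have : 0 <= delta * delta by rewrite mulr_ge0.
have : 0 <= delta * (1 / expR 1) by rewrite mulr_ge0// ltW.
lra.
Qed.
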